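(* Let $S$ be a finite generating set of $\mathbb{Z}^n$ and let $\Gamma=\mathrm{Cay}(\mathbb{Z}^n;S)$. Then $\mathrm{Aut}(\Gamma)$ has a unique regular subgroup isomorphic to $\mathbb{Z}^n$.
   Context: For a subset $S\subseteq\mathbb{Z}^n\setminus\{0\}$, the Cayley digraph $\mathrm{Cay}(\mathbb{Z}^n;S)$ has vertex set $\mathbb{Z}^n$ and an arc from $x$ to $x+s$ for all $x\in\mathbb{Z}^n$, $s\in S$ (regarded as an undirected graph if $S=-S$). $\mathrm{Aut}(\Gamma)$ is the group of (di)graph automorphisms of $\Gamma$. A subgroup of $\mathrm{Aut}(\Gamma)$ is regular if it acts regularly (transitively with trivial point stabilisers) on the vertex set of $\Gamma$. ''Generating'' means generating as a group. *)

(* Defs.v *)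
From HB Require Import structures.
From mathcomp Require Import all_boot all_order all_algebra.
From mathcomp Require Import boolp classical_sets functions cardinality.

Set Implicit Arguments.
Unset Strict Implicit.
Unset Printing Implicit Defensive.

Import GRing.Theory.
Local Open Scope classical_set_scope.
Local Open Scope ring_scope.

(* A digraph on V is given by its arc relation, E x y meaning x -> y.  An
   undirected graph is a symmetric such relation, so that digraph and graph
   automorphisms coincide for it. *)
Section DigraphAut.
Variables (V : Type) (E : V -> V -> Prop).

Record digraph_aut := DigraphAut {
  aut_fun :> V -> V;
  aut_bij : bijective aut_fun;
  aut_arc : forall x y, E (aut_fun x) (aut_fun y) <-> E x y
}.

Lemma aut_eqP (g h : digraph_aut) : g =1 h -> g = h.
Proof.
case: g h => [g bg ag] [h bh ah] /= /funext gh.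
by subst h; rewrite (Prop_irrelevance bg bh) (Prop_irrelevance ag ah).
Qed.

Definition aut_one : digraph_aut :=
  @DigraphAut id (inv_bij (fun=> erefl)) (fun _ _ => iff_refl _).

Definition aut_mul (g h : digraph_aut) : digraph_aut :=
  @DigraphAut (g \o h) (bij_comp (aut_bij g) (aut_bij h))
    (fun x y => iff_trans (aut_arc g (h x) (h y)) (aut_arc h x y)).

Lemma aut_inv_subproof (g : digraph_aut) :
  {h : digraph_aut | cancel g h /\ cancel h g}.
Proof.
apply: cid; have [f gK fK] := aut_bij g.
have fb : bijective f by exists g.
have fa x y : E (f x) (f y) <-> E x y.
  by have := aut_arc g (f x) (f y); rewrite !fK => -[? ?]; split.
by exists (DigraphAut fb fa).
Qed.

Definition aut_inv (g : digraph_aut) : digraph_aut := sval (aut_inv_subproof g).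

Lemma aut_mulA : associative aut_mul.
Proof. by move=> f g h; apply: aut_eqP. Qed.

Lemma aut_mul1 : left_id aut_one aut_mul.
Proof. by move=> g; apply: aut_eqP. Qed.

Lemma aut_mulr1 : right_id aut_one aut_mul.
Proof. by move=> g; apply: aut_eqP. Qed.

Lemma aut_mulV : left_inverse aut_one aut_inv aut_mul.
Proof.
move=> g; apply: aut_eqP => x /=.
by rewrite /aut_inv; case: aut_inv_subproof => h /= [gK _]; rewrite gK.
Qed.

Lemma aut_mulrV : right_inverse aut_one aut_inv aut_mul.
Proof.
move=> g; apply: aut_eqP => x /=.
by rewrite /aut_inv; case: aut_inv_subproof => h /= [_ hK]; rewrite hK.
Qed.

HB.instance Definition _ := gen_eqMixin digraph_aut.
HB.instance Definition _ := gen_choiceMixin digraph_aut.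
HB.instance Definition _ := @isGroup.Build digraph_aut
  aut_one aut_inv aut_mul aut_mulA aut_mul1 aut_mulr1 aut_mulV aut_mulrV.

Definition regular_on_vertices (H : set digraph_aut) : Prop :=
  (forall x y : V, exists2 g, H g & g x = y) /\
  (forall (x : V) g, H g -> g x = x -> g = 1%g).

End DigraphAut.

Definition is_subgroup (G : groupType) (H : set G) : Prop :=
  group_closed (mem H).

(* The subgroup H of the multiplicative group G, with the law induced by G, is
   isomorphic to the additive group A. *)
Definition isomorphic_to_zmod (A : zmodType) (G : groupType) (H : set G) :
    Prop :=
  exists2 phi : A -> G,
    {morph phi : x y / x + y >-> (x * y)%g} & set_bij setT H phi.

Definition zmod_generated (A : zmodType) (S : set A) : set A :=
  smallest (fun B : set A => zmod_closed (mem B)) S.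

Definition cay_arc (A : zmodType) (S : set A) (x y : A) : Prop :=
  exists2 s, S s & y = x + s.

(* Main.v *)
Require Import Defs.
From mathcomp Require Import all_boot all_order all_algebra.
From mathcomp Require Import boolp classical_sets functions cardinality.
From mathcomp Require Import ring.

(** The translations form a regular subgroup isomorphic to Z^n; the content is
    that there is no other. If phi : Z^n -> H is an isomorphism onto a regular
    subgroup, the orbit map f a = phi a 0 is a bijection of Z^n and an
    isomorphism of Cayley digraphs fixing 0 ([orbit_cay_iso]). It suffices that
    f is additive ([cay_iso_additive]), since then phi a (f b) = f (a + b) = f a
    + f b, that is, phi a is a translation.

    Write T for the given connection set and S for f^-1(T), so that f maps
    Cay(Z^n; S) to Cay(Z^n; T), and let g be the inverse of f. Call v an
    additive period of f if f (x + v) = f x + f v for all x; these v form a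
    subgroup. The proof that it is everything has two stages.

    Finite index. Let s in S be extremal, that is, not a midpoint of two other
    elements of S. Then x, x + s, x + 2s is the only path of length 2 between
    its ends, and f preserves this; on the image side, uniqueness forces the two
    steps to be equal, because swapping them gives another path. So f maps the
    progression x + ks to a progression f x + k t ([extremal_line]). The graph
    being connected, f (x + d) - f x takes finitely many values for each d
    ([displacement_finite]), so the progressions that start at different points
    remain at bounded distance, t does not depend on x, and s is an additive
    period ([extremal_period]). Extremal elements span Q^n: given a nonzero
    linear form, among the elements of S that maximise its absolute value a
    longest one is extremal ([extremal_detects]). So N Z^n consists of additive
    periods of both f and g for some N ([common_period]).

    Rigidity. Now x |-> f (x + s) - f x factors through the finite group
    (Z/N)^n, where its mean is f (N s) / N, because the increments telescope
    along the line from x to x + N s. Hence the mean of its squared length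
    exceeds |f (N s) / N|^2 by its variance ([increment_energy]). As s runs over
    S, f (x + s) - f x runs over T, and summing over s shows that the sum of
    |t|^2 over T is at least the sum of |f (N s) / N|^2 over S. The same
    argument for y |-> f (N (g y)), the linearised f composed with g, gives the
    reverse inequality. So every variance vanishes: f (x + s) - f x does not
    depend on x, every s in S is an additive period, and S generates Z^n. *)

Set Implicit Arguments.
Unset Strict Implicit.
Unset Printing Implicit Defensive.

Import Order.TTheory GRing.Theory Num.Theory.
Local Open Scope classical_set_scope.
Local Open Scope ring_scope.

(** * Subgroups, generation and additive periods *)

(** Subgroups as Prop-valued predicates: the ones used below are given by
    quantified statements, with no natural boolean form. *)
Definition subgroup_pred (A : zmodType) (P : A -> Prop) : Prop :=
  P 0 /\ forall x y, P x -> P y -> P (x - y).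

Lemma subgroup_predMn (A : zmodType) (P : A -> Prop) (x : A) (k : nat) :
  subgroup_pred P -> P x -> P (x *+ k).
Proof.
move=> [P0 PB] Px; have PN y : P y -> P (- y) by rewrite -sub0r; exact: PB.
elim: k => [|k IHk]; first by rewrite mulr0n.
by rewrite mulrS -[x *+ k]opprK; apply/PB/PN.
Qed.

Lemma subgroup_predMz (A : zmodType) (P : A -> Prop) (x : A) (k : int) :
  subgroup_pred P -> P x -> P (x *~ k).
Proof.
move=> PP Px; case: k => k; first exact: subgroup_predMn.
rewrite NegzE mulrNz -sub0r; apply: PP.2; first exact: PP.1.
exact: subgroup_predMn.
Qed.

Lemma subgroup_pred_sum (A : zmodType) (P : A -> Prop) (I : Type) (r : seq I)
    (F : I -> A) :
  subgroup_pred P -> (forall i, P (F i)) -> P (\sum_(i <- r) F i).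
Proof.
move=> PP PF; elim/big_ind: _ => //; first exact: PP.1.
move=> x y Px Py; rewrite -[y]opprK -[- y]sub0r; apply: PP.2 => //.
by apply: PP.2 => //; exact: PP.1.
Qed.

Lemma generated_ind (A : zmodType) (S : set A) (P : A -> Prop) :
  zmod_generated S = setT -> subgroup_pred P -> (forall s, S s -> P s) ->
  forall x, P x.
Proof.
move=> S_gen [P0 PB] SP x.
have PX : [set y | P y] x; last exact: PX.
have : zmod_generated S x by rewrite S_gen.
apply: smallest_sub => //; split; first by rewrite inE.
by move=> a b; rewrite !inE => /= Pa Pb; exact: PB.
Qed.

Lemma generated_intro (A : zmodType) (S : set A) :
  (forall P : A -> Prop, subgroup_pred P -> (forall s, S s -> P s) ->
    forall x, P x) -> zmod_generated S = setT.
Proof.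
move=> H; apply/seteqP; split=> // x _ B /= [[B0 BB] SB].
apply: (H B) => //; split; first by rewrite inE in B0.
by move=> a b Ba Bb; have := BB a b; rewrite !inE; apply.
Qed.

(** When f is a bijection fixing 0, these are the v such that conjugation by f
    carries the translation by v to a translation. *)
Definition additive_period (A B : zmodType) (f : A -> B) (v : A) : Prop :=
  forall x, f (x + v) = f x + f v.

Lemma additive_period_subgroup (A B : zmodType) (f : A -> B) :
  f 0 = 0 -> subgroup_pred (additive_period f).
Proof.
move=> f0; split=> [x|v w fv fw]; first by rewrite f0 !addr0.
have sh x : f (x + (v - w)) = f x + (f v - f w).
  by apply: (addIr (f w)); rewrite -fw addrA subrK fv addrA subrK.
by move=> x; rewrite sh -[in RHS](add0r (v - w)) sh f0 add0r.
Qed.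

Lemma additive_periodMn (A B : zmodType) (f : A -> B) (v : A) (k : nat) :
  f 0 = 0 -> additive_period f v -> f (v *+ k) = f v *+ k.
Proof.
by move=> f0 fv; elim: k => [|k IHk]; rewrite ?f0 // !mulrSr fv IHk.
Qed.

(** * Isomorphisms of Cayley digraphs *)

(** The inverse is part of the data and the base point is fixed, so that the
    notion is symmetric in the two sides ([cay_iso_sym]): the argument
    constantly passes from f to g. *)
Record cay_iso (A B : zmodType) (S : seq A) (T : seq B) (f : A -> B)
    (g : B -> A) : Prop := CayIso {
  cay_isoK : cancel f g;
  cay_isoVK : cancel g f;
  cay_iso0 : f 0 = 0;
  cay_iso_arc : forall x y, (f y - f x \in T) = (y - x \in S)
}.

Lemma cay_iso_sym (A B : zmodType) (S : seq A) (T : seq B) f g :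
  cay_iso S T f g -> cay_iso T S g f.
Proof.
case=> fK gK f0 fa; split=> //; first by rewrite -f0 fK.
by move=> x y; rewrite -fa !gK.
Qed.

Lemma cay_iso_diff (A B : zmodType) (S : seq A) (T : seq B) f g x s :
  cay_iso S T f g -> (f (x + s) - f x \in T) = (s \in S).
Proof. by move=> fg; rewrite (cay_iso_arc fg) addrC addKr. Qed.

(** The out-neighbours of x are mapped bijectively onto those of f x.  This is
    what makes the sum over S of a function of f (x + s) - f x independent
    of x. *)
Lemma cay_iso_perm (A B : zmodType) (S : seq A) (T : seq B) f g x :
  cay_iso S T f g -> uniq S -> uniq T ->
  perm_eq [seq f (x + s) - f x | s <- S] T.
Proof.
move=> fg uS uT; apply: uniq_perm => //.
  rewrite map_inj_uniq // => s t /addIr/(can_inj (cay_isoK fg)).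
  exact: addrI.
move=> t; apply/mapP/idP => [[s sS ->]|tT].
  by rewrite (cay_iso_diff _ _ fg).
exists (g (f x + t) - x); last first.
  by rewrite subrKC (cay_isoVK fg) addrC addKr.
by rewrite -(cay_iso_arc fg) (cay_isoVK fg) addrC addKr.
Qed.

(** Generation of the group is connectedness of the digraph, which f
    preserves.  For a subgroup P containing S, the set f(P) is stable under
    steps in T and under their inverses, hence is everything; the predicate Q
    below is the group of translations that preserve f(P). *)
Lemma cay_iso_generated (A B : zmodType) (S : seq A) (T : seq B) f g :
  cay_iso S T f g -> zmod_generated [set` T] = setT ->
  zmod_generated [set` S] = setT.
Proof.
move=> fg T_gen; apply: generated_intro => P PP SP x.
pose Q d := forall z, P (g (z + d)) <-> P (g z).
have PN y : P y -> P (- y).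
  by move=> Py; rewrite -sub0r; apply: PP.2; [exact: PP.1|].
have PD y z : P y -> P z -> P (y + z).
  by move=> Py Pz; rewrite -[z]opprK; apply/PP.2/PN.
have Qall : forall d, Q d.
  apply: (generated_ind T_gen); first split.
  - by move=> z; rewrite addr0.
  - move=> d e Qd Qe z; have := Qe (z + (d - e)).
    rewrite -(addrA z) subrK => -[? ?]; have [? ?] := Qd z; tauto.
  - move=> t tT z; have gS : P (g (z + t) - g z).
      by apply: SP; rewrite /= (cay_iso_diff _ _ (cay_iso_sym fg)).
    split=> [Pt|Pz]; last by rewrite -(subrK (g z) (g _)); exact: PD.
    by rewrite -(subKr (g (z + t)) (g z)); exact: PP.2.
have := Qall (f x) 0; rewrite add0r (cay_isoK fg) (cay_iso0 (cay_iso_sym fg)).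
by move=> ->; exact: PP.1.
Qed.

(** * Extremal elements and arithmetic progressions *)

(** A Lipschitz property that needs no norm: d is a word of some length L in
    S and its negatives, so f (x + d) - f x is a word of length L in T and its
    negatives, and these are finitely many. *)
Lemma displacement_finite (A B : zmodType) (S : seq A) (T : seq B) f g d :
  cay_iso S T f g -> zmod_generated [set` S] = setT ->
  exists D : seq B, forall x, f (x + d) - f x \in D.
Proof.
move=> fg S_gen; move: d; apply: (generated_ind S_gen); first split.
- by exists [:: 0] => x; rewrite addr0 subrr inE.
- move=> d e [D Dd] [E Ee]; exists [seq a - b | a <- D, b <- E] => x.
  have -> : f (x + (d - e)) - f x =
      (f (x + d) - f x) - (f (x + (d - e) + e) - f (x + (d - e))).
    rewrite -(addrA x) subrK opprB addrC [RHS]addrC.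
    by rewrite addrA addrAC addrA !subrK.
  exact: allpairs_f.
- by move=> s sS; exists T => x; rewrite (cay_iso_diff _ _ fg).
Qed.

(** Weaker than being a vertex of the convex hull of S, but exactly the
    uniqueness of the path of length 2 from 0 to 2s. *)
Definition extremal (A : zmodType) (S : seq A) (s : A) : Prop :=
  s \in S /\ forall a b, a \in S -> b \in S -> a + b = s *+ 2 -> a = s.

Lemma extremal_line (A B : zmodType) (S : seq A) (T : seq B) f g s x k :
  cay_iso S T f g -> extremal S s ->
  f (x + s *+ k) = f x + (f (x + s) - f x) *+ k.
Proof.
move=> fg [sS s_ext].
have step y : f (y + s + s) - f (y + s) = f (y + s) - f y.
  (* The path from f y to f (y + 2s) with its two steps swapped goes through z;
     pulled back by g, its two steps lie in S and add up to 2s. *)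
  pose z := f y + (f (y + s + s) - f (y + s)).
  have gz : f (g z) = z by exact: (cay_isoVK fg).
  have az : g z - y \in S.
    by rewrite -(cay_iso_arc fg) gz addrC addKr (cay_iso_diff _ _ fg).
  have bz : y + s + s - g z \in S.
    rewrite -(cay_iso_arc fg) gz.
    have -> : f (y + s + s) - z = f (y + s) - f y.
      by rewrite /z opprD opprB addrCA subrKC addrC.
    by rewrite (cay_iso_diff _ _ fg).
  have /(s_ext _ _ az bz) gzE : g z - y + (y + s + s - g z) = s *+ 2.
    by rewrite addrC addrA subrK -2!addrA addrC -addrA subrK mulr2n.
  have : f (y + s) = z by rewrite -gz -gzE subrKC.
  by move=> {2}->; rewrite /z [RHS]addrC addKr.
have steps j : f (x + s *+ j + s) - f (x + s *+ j) = f (x + s) - f x.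
  elim: j => [|j <-]; first by rewrite addr0.
  by rewrite mulrSr addrA step.
elim: k => [|k IHk]; first by rewrite !addr0.
by rewrite !mulrSr (addrA x) (addrA (f x)) -IHk -(steps k) subrKC.
Qed.

Lemma multiples_escape (n : nat) (D : seq 'rV[int]_n) (a t : 'rV[int]_n) :
  (forall k, a + t *+ k \in D) -> t = 0.
Proof.
move=> tD; apply/eqP; apply: contraT => /rV0Pn[i ti].
pose r := [seq a + t *+ k | k <- iota 0 (size D).+1].
have ur : uniq r.
  rewrite map_inj_uniq ?iota_uniq // => k l /addrI/rowP/(_ i).
  by rewrite !mulmxnE; apply: mulrIn.
have /(uniq_leq_size ur) : {subset r <= D} by move=> _ /mapP[k _ ->].
by rewrite size_map size_iota ltnn.
Qed.

(** The progressions f x + k t and k (f s), the images of x + ks and ks, differ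
    by the displacement of f along x.  It takes finitely many values, so the
    two have the same direction. *)
Lemma extremal_period (A : zmodType) (n : nat) (S : seq A)
    (T : seq 'rV[int]_n) f g s :
  cay_iso S T f g -> zmod_generated [set` S] = setT -> extremal S s ->
  additive_period f s.
Proof.
move=> fg S_gen s_ext x; have [D fD] := displacement_finite x fg S_gen.
suff /subr0_eq <- : f (x + s) - f x - f s = 0 by rewrite subrKC.
apply: (@multiples_escape _ D (f x)) => k.
have := fD (s *+ k); rewrite [s *+ k + x]addrC (extremal_line _ _ fg s_ext).
rewrite -[s *+ k]add0r (extremal_line _ _ fg s_ext) (cay_iso0 fg).
by rewrite !add0r subr0 -addrA -mulrnBl.
Qed.

Definition sqnorm (n : nat) (x : 'rV[int]_n) : int := \sum_i x 0 i ^+ 2.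

Lemma sqnorm_ge0 n (x : 'rV[int]_n) : 0 <= sqnorm x.
Proof. by apply: sumr_ge0 => i _; exact: sqr_ge0. Qed.

Lemma sqnorm_le0 n (x : 'rV[int]_n) : sqnorm x <= 0 -> x = 0.
Proof.
move=> x_le0; have /eqP : sqnorm x = 0.
  by apply/eqP; rewrite eq_le x_le0 sqnorm_ge0.
rewrite psumr_eq0 => [/allP x0|i _]; last exact: sqr_ge0.
apply/rowP => i; rewrite mxE; apply/eqP; rewrite -sqrf_eq0.
exact: (x0 i (mem_index_enum i)).
Qed.

Lemma sqnorm_parallelogram n (s a b : 'rV[int]_n) :
  a + b = s *+ 2 ->
  sqnorm a + sqnorm b = sqnorm s *+ 2 + sqnorm (a - s) *+ 2.
Proof.
move=> /rowP abs; rewrite /sqnorm -!sumrMnl -!big_split /=.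
apply: eq_bigr => i _; have := abs i; rewrite mulmxnE !mxE => abi.
have -> : b 0 i = s 0 i *+ 2 - a 0 i by rewrite -abi addrAC subrr add0r.
ring.
Qed.

Lemma seq_argmax (I : eqType) (d : Order.disp_t) (R : orderType d) (F : I -> R)
    (r : seq I) (x : I) :
  x \in r -> exists2 m, m \in r & forall y, y \in r -> (F y <= F m)%O.
Proof.
elim: r x => // a r IHr x _; case: r => [|b r] in IHr *.
  by exists a => [|y]; rewrite ?inE // => /eqP ->.
have [m mr m_max] := IHr b (mem_head _ _).
case: (leP (F a) (F m)) => [am|/ltW ma].
  exists m => [|y]; first by rewrite inE mr orbT.
  by rewrite inE => /predU1P[->|/m_max].
exists a => [|y]; first exact: mem_head.
by rewrite inE => /predU1P[->|/m_max/le_trans] //; apply.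
Qed.

(** Maximise |l|, then the length.  If a + b = 2s, maximality of |l s| forces
    l a = l b = l s, so a and b compete with s for the length, and the
    parallelogram law forces a = s. *)
Lemma extremal_detects n (S : seq 'rV[int]_n) (R : realDomainType)
    (l : 'rV[int]_n -> R) :
  {morph l : x y / x + y} -> (exists2 s, s \in S & l s != 0) ->
  exists2 s, extremal S s & l s != 0.
Proof.
move=> lD [s0 s0S ls0].
have [m mS m_max] := seq_argmax (fun x => l x ^+ 2) s0S.
have lm : l m != 0.
  apply: contra_neq ls0 => lm0; apply/eqP.
  rewrite -sqrf_eq0 eq_le sqr_ge0 andbT.
  by have := m_max s0 s0S; rewrite lm0 expr0n.
have mF : m \in [seq x <- S | l x == l m] by rewrite mem_filter eqxx.
have [s] := seq_argmax (@sqnorm n) mF.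
rewrite mem_filter => /andP[/eqP lsm sS] s_max.
exists s; last by rewrite lsm.
split=> // a b aS bS abs.
have labs : l a + l b = l m *+ 2 by rewrite -lD abs mulr2n lD lsm mulr2n.
have lb : l b = l m *+ 2 - l a by rewrite -labs addrC addKr.
have lam : l a = l m.
  have := m_max a aS; have := m_max b bS; rewrite /= lb => hb ha.
  apply/eqP; rewrite -subr_eq0 -sqrf_eq0 eq_le sqr_ge0 andbT.
  have dE : (l a - l m) ^+ 2 *+ 2 =
      (l a ^+ 2 - l m ^+ 2) + ((l m *+ 2 - l a) ^+ 2 - l m ^+ 2) by ring.
  rewrite -(pmulrn_lle0 _ (ltn0Sn 1)) dE -(addr0 0).
  by apply: lerD; rewrite subr_le0.
have sqa : sqnorm a <= sqnorm s by apply: s_max; rewrite mem_filter lam eqxx.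
have sqb : sqnorm b <= sqnorm s.
  by apply: s_max; rewrite mem_filter lb lam mulr2n addrK eqxx.
have sqab := sqnorm_parallelogram abs.
apply/subr0_eq/sqnorm_le0; rewrite -(pmulrn_lle0 _ (ltn0Sn 1)).
by rewrite -(lerD2l (sqnorm s *+ 2)) -sqab addr0 mulr2n lerD.
Qed.

(** * A lattice of additive periods *)

Lemma common_denominator m n (B : 'M[rat]_(m, n)) :
  exists (d : int) (C : 'M[int]_(m, n)),
    0 < d /\ map_mx intr C = d%:~R *: B.
Proof.
pose P : int := \prod_(p : 'I_m * 'I_n) denq (B p.1 p.2).
pose Q i j : int :=
  \prod_(p : 'I_m * 'I_n | p != (i, j)) denq (B p.1 p.2).
exists P, (\matrix_(i, j) (numq (B i j) * Q i j)); split.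
  by apply: prodr_gt0 => p _; exact: denq_gt0.
apply/matrixP => i j; rewrite !mxE intrM numqE /P (bigD1 (i, j)) //= intrM.
by rewrite -/(Q i j); ring.
Qed.

(** A family in Z^n that no nonzero rational linear form kills has rank n, so
    its integer matrix A has a left inverse over Q; clearing denominators gives
    an integer C with C A = N, and the rows of C express the vectors N e_i
    through the family. *)
Lemma spanning_multiples n (R : seq 'rV[int]_n) :
  (forall c : 'cV[rat]_n, c != 0 ->
    exists2 v, v \in R & (map_mx intr v *m c) 0 0 != 0) ->
  exists2 N : nat, (0 < N)%N &
    forall P : 'rV[int]_n -> Prop, subgroup_pred P ->
      {in R, forall v, P v} -> forall v, P (v *+ N).
Proof.
move=> Rspan; pose A : 'M[int]_(size R, n) := \matrix_(i < size R) R`_i.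
have /row_fullP[B BA] : row_full (map_mx (intr : int -> rat) A).
  rewrite -cokermx_eq0; apply: contraT => /matrix0Pn[i [j Kij]].
  have /Rspan[v vR] : col j (cokermx (map_mx (intr : int -> rat) A)) != 0.
    by apply/cV0Pn; exists i; rewrite mxE.
  have iR : (index v R < size R)%N by rewrite index_mem.
  have -> : v = row (Ordinal iR) A by rewrite rowK nth_index.
  by rewrite colE map_row -row_mul mulmxA mulmx_coker mul0mx !mxE eqxx.
have [d [C [d_gt0 CB]]] := common_denominator B.
have CA : C *m A = d%:M.
  apply/matrixP => i j; apply: (@intr_inj rat).
  have /matrixP/(_ i j) :
      map_mx (intr : int -> rat) (C *m A) = map_mx intr d%:M.
    by rewrite map_mxM CB -scalemxAl BA map_scalar_mx /= scalemx1.
  by rewrite !mxE.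
exists `|d|%N => [|P PP PR v]; first by rewrite absz_gt0 gt_eqF.
have -> : v *+ `|d| = \sum_i (row i A) *~ ((v *m C) 0 i).
  rewrite pmulrn gez0_abs ?ltW // -scaler_int intz -mul_mx_scalar -CA mulmxA.
  by rewrite mulmx_sum_row; apply: eq_bigr => i _; rewrite -scaler_int intz.
apply: subgroup_pred_sum => // i; apply: subgroup_predMz => //.
by apply: PR; rewrite rowK mem_nth.
Qed.

Lemma period_multiples n (S T : seq 'rV[int]_n) f g :
  cay_iso S T f g -> zmod_generated [set` S] = setT ->
  exists2 N : nat, (0 < N)%N & forall v, additive_period f (v *+ N).
Proof.
move=> fg S_gen.
have [|N N_gt0 HN] := @spanning_multiples n [seq s <- S | `[<extremal S s>]].
  move=> c c_neq0.
  pose l (x : 'rV[int]_n) : rat := (map_mx intr x *m c) 0 0.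
  have lD : {morph l : x y / x + y}.
    by move=> x y; rewrite /l map_mxD mulmxDl mxE.
  have [|s s_ext ls] := @extremal_detects n S _ l lD; last first.
    by exists s => //; rewrite mem_filter s_ext.1 andbT; apply/asboolP.
  apply: contrapT => l0; have /cV0Pn[i /eqP[]] := c_neq0.
  have -> : c i 0 = l (delta_mx 0 i).
    by rewrite /l map_delta_mx -rowE mxE.
  apply: (generated_ind (P := fun x => l x = 0) S_gen).
    split=> [|x y lx ly]; first by apply: (addIr (l 0)); rewrite -lD !add0r.
    by apply: (addIr (l y)); rewrite -lD subrK lx ly addr0.
  by move=> s sS; apply/eqP; apply: contra_notT l0 => ls; exists s.
exists N => // v; apply: (HN (additive_period f)).
  exact: additive_period_subgroup (cay_iso0 fg).
by move=> s; rewrite mem_filter => /andP[/asboolP /(extremal_period fg S_gen)].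
Qed.

(** * Averages over a box *)

Definition box_lift (N n : nat) (b : 'rV['Z_N]_n) : 'rV[int]_n :=
  map_mx (fun z : 'Z_N => (z : nat)%:Z) b.

(** The type 'Z_N is the ring of residues modulo N only for N > 1, whence this
    hypothesis here and below. *)
Lemma box_liftP (N n : nat) (x : 'rV[int]_n) : (1 < N)%N ->
  exists w, x = box_lift (map_mx intr x : 'rV['Z_N]_n) + w *+ N.
Proof.
move=> N_gt1; exists (\row_i divz (x 0 i) N); apply/rowP => i.
rewrite mxE mulmxnE !mxE [LHS](divz_eq _ N%:Z) addrC -mulr_natr natz.
congr (_ + _).
set z := x 0 i; rewrite {2}(divz_eq z N%:Z).
have /gez0_abs <- : 0 <= (z %% N)%Z by rewrite modz_ge0 // -lt0n ltnW.
rewrite intrD intrM -[N%:Z%:~R]/(N%:R) pchar_Zp // mulr0 add0r.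
rewrite -[`|_|%N%:~R]/(`|(z %% N)%Z|%:R) val_Zp_nat // modn_small //.
by rewrite -ltz_nat gez0_abs ?modz_ge0 ?ltz_pmod // -?lt0n ?ltz_nat ltnW.
Qed.

(** A function that is periodic modulo N is a function on (Z/N)^n, and
    translations permute that group. *)
Lemma box_sum_shift (M : zmodType) (N n : nat) (g : 'rV[int]_n -> M)
    (v : 'rV[int]_n) : (1 < N)%N -> (forall x w, g (x + w *+ N) = g x) ->
  \sum_(b : 'rV['Z_N]_n) g (box_lift b + v) =
  \sum_(b : 'rV['Z_N]_n) g (box_lift b).
Proof.
move=> N_gt1 gN; pose p : 'rV['Z_N]_n := map_mx intr v.
rewrite [RHS](reindex_inj (addIr p)); apply: eq_bigr => b _ /=.
have [w ->] := box_liftP (box_lift b + v) N_gt1; rewrite gN map_mxD.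
congr (g (box_lift (_ + _))); apply/rowP => i; rewrite !mxE.
by rewrite -[LHS]/((b 0 i : nat)%:R) natr_Zp.
Qed.

(** The mean square is the squared mean plus the variance, multiplied by
    N^2 #|I| to stay in the integers; the mean of d is F / N. *)
Lemma variance_sum (I : finType) (d : I -> int) (F : int) (N : nat) :
  (\sum_i d i) *+ N = F *+ #|I| ->
  (\sum_i d i ^+ 2) *+ N ^ 2 =
    F ^+ 2 *+ #|I| + \sum_i (d i *+ N - F) ^+ 2.
Proof.
move=> dF.
have -> : \sum_i (d i *+ N - F) ^+ 2 =
    (\sum_i d i ^+ 2) *+ N ^ 2 - (\sum_i d i) *+ N * F *+ 2 + F ^+ 2 *+ #|I|.
  rewrite -sumr_const -!sumrMnl mulr_suml -sumrMnl -sumrB -big_split /=.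
  by apply: eq_bigr => i _; rewrite sqrrB exprMn_n -mulrnAr.
rewrite dF; move: (_ *+ N ^ 2) => u; rewrite mulrnAl -expr2; ring.
Qed.

Lemma periodic_increment (A B : zmodType) (f : A -> B) (v s x : A) :
  additive_period f v -> f (x + v + s) - f (x + v) = f (x + s) - f x.
Proof.
by move=> fv; rewrite addrAC !fv opprD addrACA subrr addr0.
Qed.

(** Add the sums over the translates of the box by 0, s, 2s, up to (N-1)s: they
    are all equal, and over each point of the box the increments telescope. *)
Lemma increment_sum (N n m : nat) (f : 'rV[int]_n -> 'rV[int]_m)
    (s : 'rV[int]_n) : (1 < N)%N -> (forall v, additive_period f (v *+ N)) ->
  (\sum_(b : 'rV['Z_N]_n) (f (box_lift b + s) - f (box_lift b))) *+ N =
  f (s *+ N) *+ #|{: 'rV['Z_N]_n}|.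
Proof.
move=> N_gt1 fN; pose g x := f (x + s) - f x.
have gN x w : g (x + w *+ N) = g x by exact: periodic_increment.
transitivity (\sum_(k < N) \sum_(b : 'rV['Z_N]_n) g (box_lift b + s *+ k)).
  under [RHS]eq_bigr => k _ do rewrite (box_sum_shift (s *+ k) N_gt1 gN).
  by rewrite sumr_const card_ord.
rewrite exchange_big /= -sumr_const; apply: eq_bigr => b _.
have -> : f (s *+ N) = f (box_lift b + s *+ N) - f (box_lift b).
  by rewrite fN addrC addKr.
rewrite -(big_mkord xpredT (fun k => g (box_lift b + s *+ k))).
under eq_bigr => k _ do rewrite /g -addrA -mulrSr.
by rewrite (telescope_sumr (fun k => f (box_lift b + s *+ k))) // addr0.
Qed.

Lemma increment_energy (N n m : nat) (f : 'rV[int]_n -> 'rV[int]_m)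
    (s : 'rV[int]_n) : (1 < N)%N -> (forall v, additive_period f (v *+ N)) ->
  (\sum_(b : 'rV['Z_N]_n) sqnorm (f (box_lift b + s) - f (box_lift b)))
      *+ N ^ 2 =
  sqnorm (f (s *+ N)) *+ #|{: 'rV['Z_N]_n}| +
  \sum_(b : 'rV['Z_N]_n)
    sqnorm ((f (box_lift b + s) - f (box_lift b)) *+ N - f (s *+ N)).
Proof.
move=> N_gt1 fN; have /rowP dF := increment_sum s N_gt1 fN.
rewrite /sqnorm [X in X *+ _ = _]exchange_big [X in _ = _ + X]exchange_big /=.
rewrite -!sumrMnl -big_split /=; apply: eq_bigr => i _.
have := dF i; rewrite !mulmxnE summxE => /variance_sum ->.
by congr (_ + _); apply: eq_bigr => b _; rewrite !mxE mulmxnE !mxE.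
Qed.

(** * Additivity of isomorphisms *)

(** g carries the translation by w to the translation by g w, so f carries it
    back. *)
Lemma additive_period_inv (A B : zmodType) (S : seq A) (T : seq B) f g w :
  cay_iso S T f g -> additive_period g w -> additive_period f (g w).
Proof.
move=> fg gw x; apply: (can_inj (cay_isoVK fg)).
by rewrite (cay_isoK fg) (cay_isoVK fg) gw (cay_isoK fg).
Qed.

Lemma cay_iso_sum (A B C : zmodType) (S : seq A) (T : seq B) f g (F : B -> C)
    (x : A) :
  cay_iso S T f g -> uniq S -> uniq T ->
  \sum_(s <- S) F (f (x + s) - f x) = \sum_(t <- T) F t.
Proof.
move=> fg uS uT.
by rewrite -(perm_big _ (cay_iso_perm x fg uS uT)) big_map.
Qed.

Lemma matrix_mulrIn m n (N : nat) :
  (0 < N)%N -> injective (fun x : 'M[int]_(m, n) => x *+ N).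
Proof.
move=> N_gt0 x y /matrixP xy; apply/matrixP => i j; apply/eqP.
have /eqP := xy i j; rewrite !mulmxnE -subr_eq0 -mulrnBl mulrn_eq0 subr_eq0.
by rewrite eqn0Ngt N_gt0.
Qed.

Lemma common_period n (S T : seq 'rV[int]_n) f g :
  cay_iso S T f g ->
  zmod_generated [set` S] = setT -> zmod_generated [set` T] = setT ->
  exists2 N : nat, (1 < N)%N &
    forall v, additive_period f (v *+ N) /\ additive_period g (v *+ N).
Proof.
move=> fg S_gen T_gen; have gf := cay_iso_sym fg.
have [N N_gt0 fN] := period_multiples fg S_gen.
have [M M_gt0 gM] := period_multiples gf T_gen.
(* The factor 2 makes the period greater than 1, as 'Z_N needs. *)
exists (2 * (N * M))%N => [|v].
  by rewrite mul2n -addnn (@leq_add 1 1) // muln_gt0 N_gt0 M_gt0.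
split; first by rewrite mulnC -mulnA mulrnA mulrnAC; exact: fN.
by rewrite mulnA mulrnA; exact: gM.
Qed.

(** The energy comparison: the sums of squared lengths over T and of the
    linearised f over S bound each other, through f and through h, so that
    nothing is left for the variance of the increments. *)
Lemma cay_iso_additive n (S T : seq 'rV[int]_n) f g :
  cay_iso S T f g -> uniq S -> uniq T -> zmod_generated [set` T] = setT ->
  {morph f : x y / x + y}.
Proof.
move=> fg uS uT T_gen; have S_gen := cay_iso_generated fg T_gen.
have gf := cay_iso_sym fg.
have [N N_gt1 per] := common_period fg S_gen T_gen.
have N_gt0 : (0 < N)%N := ltnW N_gt1.
have fN v : additive_period f (v *+ N) by have [] := per v.
have gN v : additive_period g (v *+ N) by have [] := per v.
(* F is N times the linear map that f follows on the large scale; h composes it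
   with g, so that h follows multiplication by N. *)
pose F v := f (v *+ N).
have FB v w : F (v - w) = F v - F w.
  by apply: (addIr (F w)); rewrite subrK -fN -mulrnDl subrK.
pose h y := F (g y).
have hN w : additive_period h (w *+ N).
  by move=> y; rewrite /h gN /F mulrnDl fN.
have h_mul w : h (w *+ N) = w *+ N *+ N.
  rewrite /h /F additive_periodMn ?(cay_isoVK fg) ?(cay_iso0 fg) //.
  exact: additive_period_inv fg (gN w).
pose K := #|{: 'rV['Z_N]_n}|.
pose ES := \sum_(s <- S) sqnorm (F s).
pose ET := \sum_(t <- T) sqnorm t.
(* V s is N^2 times the variance of the increment of f along s, summed over the
   box rather than averaged. *)
pose V s := \sum_(b : 'rV['Z_N]_n)
  sqnorm ((f (box_lift b + s) - f (box_lift b)) *+ N - F s).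
have V_ge0 s : 0 <= V s by apply: sumr_ge0 => b _; exact: sqnorm_ge0.
have f_energy : ET *+ K *+ N ^ 2 = ES *+ K + \sum_(s <- S) V s.
  rewrite /ES -[X in _ = X + _]sumrMnl -big_split /=.
  transitivity ((\sum_(s <- S) \sum_(b : 'rV['Z_N]_n)
      sqnorm (f (box_lift b + s) - f (box_lift b))) *+ N ^ 2).
    rewrite exchange_big /=.
    under eq_bigr => b _ do rewrite (cay_iso_sum (@sqnorm n) _ fg uS uT).
    by rewrite sumr_const.
  by rewrite -sumrMnl; apply: eq_bigr => s _; rewrite increment_energy.
have h_energy : ET *+ N ^ 4 *+ K <= ES *+ K *+ N ^ 2.
  have -> : ES *+ K *+ N ^ 2 = (\sum_(t <- T) \sum_(b : 'rV['Z_N]_n)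
      sqnorm (h (box_lift b + t) - h (box_lift b))) *+ N ^ 2.
    rewrite exchange_big /=; congr (_ *+ _).
    under eq_bigr => b _.
      under eq_bigr => t _ do rewrite -FB.
      rewrite (cay_iso_sum (fun v => sqnorm (F v)) _ gf uT uS).
      over.
    by rewrite sumr_const.
  rewrite -!sumrMnl; apply: ler_sum => t _.
  rewrite increment_energy // h_mul.
  have -> : sqnorm (t *+ N *+ N) = sqnorm t *+ N ^ 4.
    rewrite /sqnorm -sumrMnl; apply: eq_bigr => i _.
    by rewrite !mulmxnE -mulrnA exprMn_n mulnn -expnM.
  by rewrite lerDl; apply: sumr_ge0 => b _; exact: sqnorm_ge0.
have V_sum0 : \sum_(s <- S) V s = 0.
  apply/eqP; rewrite eq_le sumr_ge0 // andbT.
  have N2_gt0 : (0 < N ^ 2)%N by rewrite expn_gt0 N_gt0.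
  rewrite -(pmulrn_lle0 _ N2_gt0) -(lerD2l (ES *+ K *+ N ^ 2)) addr0.
  by rewrite -mulrnDl -f_energy -mulrnA -expnD mulrnAC.
have incr s x : s \in S -> (f (x + s) - f x) *+ N = F s.
  move=> sS; have [w xE] := box_liftP x N_gt1.
  rewrite xE (periodic_increment _ _ (fN w)); move: (map_mx _ x) => b.
  apply/eqP; rewrite -subr_eq0; apply/eqP/sqnorm_le0.
  have /eqP : V s = 0.
    move/eqP: V_sum0; rewrite psumr_eq0 // => /allP/(_ s sS)/eqP; exact.
  rewrite /V psumr_eq0 => [/allP/(_ b)|c _]; last exact: sqnorm_ge0.
  by rewrite mem_index_enum => /(_ isT)/eqP ->.
have all_periods : forall v, additive_period f v.
  apply: (generated_ind S_gen).
    exact: additive_period_subgroup (cay_iso0 fg).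
  move=> s sS x; suff <- : f (x + s) - f x = f s by rewrite subrKC.
  apply: (matrix_mulrIn N_gt0); rewrite /= incr //.
  by rewrite -(incr s 0 sS) add0r (cay_iso0 fg) subr0.
by move=> x y; exact: all_periods.
Qed.

(** * Regular subgroups *)

Lemma cay_arcE (A : zmodType) (S : set A) (x y : A) :
  cay_arc S x y <-> S (y - x).
Proof.
split=> [[s Ss ->]|Sxy]; first by rewrite addrC addKr.
by exists (y - x); rewrite ?subrKC.
Qed.

Lemma translation_bij (A : zmodType) (v : A) : bijective (+%R v).
Proof. by exists (+%R (- v)) => x; rewrite ?addKr ?addNKr. Qed.

Lemma translation_arc (A : zmodType) (S : set A) (v x y : A) :
  cay_arc S (v + x) (v + y) <-> cay_arc S x y.
Proof. by rewrite !cay_arcE opprD addrACA subrr add0r. Qed.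

Definition translation (A : zmodType) (S : set A) (v : A) :
    digraph_aut (cay_arc S) :=
  DigraphAut (translation_bij v) (translation_arc S v).

Lemma translationD (A : zmodType) (S : set A) :
  {morph @translation A S : v w / v + w >-> (v * w)%g}.
Proof. by move=> v w; apply: aut_eqP => x /=; rewrite addrA. Qed.

Lemma translation_inj (A : zmodType) (S : set A) :
  injective (@translation A S).
Proof.
move=> v w vw; have : translation S v 0 = translation S w 0 by rewrite vw.
by rewrite /= !addr0.
Qed.

Lemma translations_regular_subgroup (A : zmodType) (S : set A) :
  [/\ is_subgroup (range (@translation A S)),
      regular_on_vertices (range (@translation A S)) &
      isomorphic_to_zmod A (range (@translation A S))].
Proof.
split.
- split.
    by rewrite inE; exists 0 => //; apply: aut_eqP => x /=; rewrite add0r.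
  move=> g h; rewrite !inE => -[v _ <-] [w _ <-]; exists (v - w) => //.
  by rewrite -[LHS](mulgK (translation S w)) -translationD subrK.
- split=> [x y|x _ [v _ <-] /= vx].
    by exists (translation S (y - x)); [exists (y - x) | rewrite /= subrK].
  apply: aut_eqP => y /=.
  by have -> : v = 0; [apply: (addIr x); rewrite vx add0r | rewrite add0r].
- exists (@translation A S); first exact: translationD.
  split=> [v _|v w _ _|_ [v _ <-]]; last by exists v.
    by exists v.
  exact: translation_inj.
Qed.

(** Regularity makes the orbit map of 0 a bijection.  As phi x is an
    automorphism that maps 0 to f x and f d to f (x + d), the arcs at f x are
    those at 0 moved by phi x: whether f (x + d) is an out-neighbour of f x
    depends only on d, and the pulled back digraph is a Cayley digraph. *)
Lemma orbit_cay_iso (A B : zmodType) (T : seq B)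
    (H : set (digraph_aut (cay_arc [set` T])))
    (phi : A -> digraph_aut (cay_arc [set` T])) :
  regular_on_vertices H -> {morph phi : x y / x + y >-> (x * y)%g} ->
  set_bij setT H phi ->
  exists (S : seq A) (g : B -> A),
    uniq S /\ cay_iso S (undup T) (fun a => phi a 0) g.
Proof.
move=> [H_trans H_free] phiD [phiH phi_inj phi_surj].
pose f a := phi a 0.
have phi1 : phi 0 = 1%g by apply: (mulgI (phi 0)); rewrite -phiD addr0 mulg1.
have f_inj : injective f.
  move=> a b fab; apply: phi_inj; rewrite ?inE //.
  have Hba : H (phi (- b + a)) by apply: phiH.
  have ba0 : phi (- b + a) 0 = 0.
    rewrite phiD /= -/(f a) fab -[LHS]/((phi (- b) * phi b)%g 0).
    by rewrite -phiD addNr phi1.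
  rewrite -[a](addNKr b) phiD.
  by rewrite (H_free _ _ Hba ba0) mulg1.
have f_surj y : exists a, f a = y.
  have [h Hh h0] := H_trans 0 y.
  by have [a _ ah] := phi_surj _ Hh; exists a; rewrite /f ah.
have [g fgK] := choice f_surj.
have gfK : cancel f g by move=> a; apply: f_inj; rewrite fgK.
have f0 : f 0 = 0 by rewrite /f phi1.
(* T may repeat elements, but the energy sums count each of them once. *)
exists [seq g t | t <- undup T], g; split.
  by rewrite (map_inj_uniq (can_inj fgK)) undup_uniq.
split=> // x y; rewrite -[y](subrKC x); move: (y - x) => d.
rewrite mem_undup [x + d]addrC addrK -[d in RHS]gfK.
rewrite (mem_map (can_inj fgK)) mem_undup.
have := aut_arc (phi x) 0 (f d); rewrite !cay_arcE subr0 /= => fxd.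
have -> : phi (d + x) 0 = phi x (f d) by rewrite addrC phiD.
by apply/idP/idP => /fxd.
Qed.

Theorem corollary5p6 (n : nat) (S : set 'rV[int]_n)
    (S_neq0 : ~ S 0)
    (S_fin : finite_set S)
    (S_gen : zmod_generated S = setT) :
  exists! H : set (digraph_aut (cay_arc S)),
    [/\ is_subgroup H, regular_on_vertices H & isomorphic_to_zmod 'rV[int]_n H].
Proof.
have [T ST] := (finite_seqP S).1 S_fin; subst S.
exists (range (@translation _ [set` T])); split.
  exact: translations_regular_subgroup.
move=> H [_ H_reg [phi phiD phi_bij]].
have [S [g [uS fg]]] := orbit_cay_iso H_reg phiD phi_bij.
have uT_gen : zmod_generated [set` undup T] = setT.
  by rewrite -S_gen; congr zmod_generated; apply/seteqP; split=> t /=;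
    rewrite mem_undup.
have fD := cay_iso_additive fg uS (undup_uniq T) uT_gen.
have phiE a : phi a = translation [set` T] (phi a 0).
  apply: aut_eqP => x /=; rewrite -{1}(cay_isoVK fg x).
  by rewrite -[LHS]/((phi a * phi (g x))%g 0) -phiD fD (cay_isoVK fg).
have [phiH _ phi_surj] := phi_bij.
apply/seteqP; split=> [_ [v _ <-]|h Hh].
  by rewrite -[v](cay_isoVK fg) -phiE; exact: phiH.
by have [a _ <-] := phi_surj h Hh; rewrite phiE; exists (phi a 0).
Qed.
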